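(* Consider the semi-discrete central-upwind scheme $$\frac{d}{dt}\overline{\boldsymbol U}_{i,j}=-\frac{\mathcal F_{i+\frac12,j}-\mathcal F_{i-\frac12,j}}{\Delta x}-\frac{\mathcal G_{i,j+\frac12}-\mathcal G_{i,j-\frac12}}{\Delta y}+\overline{\boldsymbol S}_{i,j},\qquad \overline{\boldsymbol U}_{i,j}=(\overline{\boldsymbol h}_{i,j}^\top,\overline{\boldsymbol q^x}_{i,j}^\top,\overline{\boldsymbol q^y}_{i,j}^\top)^\top\in\mathbb{R}^{3K},$$ for the stochastic Galerkin shallow water system, with the reconstructions and numerical fluxes $\mathcal F,\mathcal G$ defined in the context. If the source discretization is chosen as $\overline{\boldsymbol S}_{i,j}=\big((\overline{\boldsymbol S}^{(1)}_{i,j})^\top,(\overline{\boldsymbol S}^{(2)}_{i,j})^\top,(\overline{\boldsymbol S}^{(3)}_{i,j})^\top\big)^\top$ with $$\overline{\boldsymbol S}^{(1)}_{i,j}=\boldsymbol 0,\qquad \overline{\boldsymbol S}^{(2)}_{i,j}=-g\,\mathcal P(\overline{\boldsymbol h}_{i,j})\frac{\boldsymbol B_{i+\frac12,j}-\boldsymbol B_{i-\frac12,j}}{\Delta x},\qquad \overline{\boldsymbol S}^{(3)}_{i,j}=-g\,\mathcal P(\overline{\boldsymbol h}_{i,j})\frac{\boldsymbol B_{i,j+\frac12}-\boldsymbol B_{i,j-\frac12}}{\Delta y},$$ then the scheme is well-balanced: whenever the cell averages are in the stochastic lake-at-rest state, i.e. there is a constant vector $\boldsymbol\eta^*\in\mathbb{R}^K$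 such that $\overline{\boldsymbol h}_{i,j}+\overline{\boldsymbol B}_{i,j}=\boldsymbol\eta^*$ and $\overline{\boldsymbol q^x}_{i,j}=\overline{\boldsymbol q^y}_{i,j}=\boldsymbol 0$ for all cells $(i,j)$, the right-hand side of the scheme vanishes for all cells.
   Context: **Stochastic Galerkin system.** Let $\rho$ be a probability density on $\mathbb{R}^d$ with finite polynomial moments of all orders and $\langle f_1,f_2\rangle_\rho=\int f_1f_2\,\rho\,ds$. Let $\Lambda\subset\mathbb{N}_0^d$ be finite with $0\in\Lambda$, $|\Lambda|=K$, $P_\Lambda=\mathrm{span}\{\zeta^\nu:\nu\in\Lambda\}$, and $\phi_1\equiv1,\phi_2,\dots,\phi_K$ an $L^2_\rho$-orthonormal basis of $P_\Lambda$. Define $\mathcal P(\widehat z)=\sum_{k=1}^K\widehat z_k\mathcal M_k$ for $\widehat z\in\mathbb{R}^K$, with $(\mathcal M_k)_{\ell m}=\langle\phi_k,\phi_\ell\phi_m\rangle_\rho$. For $\widehat U=(\widehat h^\top,\widehat{q^x}^\top,\widehat{q^y}^\top)^\top\in\mathbb{R}^{3K}$ and gravitational constant $g>0$, $$\widehat F(\widehat U)=\begin{pmatrix}\widehat{q^x}\\ \mathcal P(\widehat{q^x})\mathcal P^{-1}(\widehat h)\widehat{q^x}+\tfrac12 g\mathcal P(\widehat h)\widehat h\\ \mathcal P(\widehat{q^x})\mathcal P^{-1}(\widehat h)\widehat{q^y}\end{pmatrix},\quad \widehat G(\widehat U)=\begin{pmatrix}\widehat{q^y}\\ \mathcal P(\widehat{q^y})\mathcal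 P^{-1}(\widehat h)\widehat{q^x}\\ \mathcal P(\widehat{q^y})\mathcal P^{-1}(\widehat h)\widehat{q^y}+\tfrac12 g\mathcal P(\widehat h)\widehat h\end{pmatrix}.$$ **Grid and bottom.** The cells $\mathcal C_{i,j}=[x_{i-\frac12},x_{i+\frac12}]\times[y_{j-\frac12},y_{j+\frac12}]$, with centers $(x_i,y_j)$, form a uniform rectangular grid with spacings $\Delta x,\Delta y$. ''All cells'' includes any neighbouring (ghost) cells entering the formulas. The bottom coefficient vector $\widehat B(x,y)\in\mathbb{R}^K$ is replaced by its continuous piecewise bilinear interpolant $\widetilde{\widehat B}$, which on each cell is the bilinear function taking at the four corners the values $\widehat B_{i\pm\frac12,j\pm\frac12}$, where each corner value is the componentwise average of the $\liminf$ and $\limsup$ of $\widehat B$ at that corner (equal to the point value if $\widehat B$ is continuous). Set $\boldsymbol B_{i+\frac12,j}=\widetilde{\widehat B}(x_{i+\frac12},y_j)$, $\boldsymbol B_{i,j+\frac12}=\widetilde{\widehat B}(x_i,y_{j+\frac12})$, and $$\overline{\boldsymbol B}_{i,j}=\frac{1}{\Delta x\Delta y}\iint_{\mathcal C_{i,j}}\widetilde{\widehat B}\,dx\,dy=\tfrac14\big(\boldsymbol B_{i+\frac12,j}+\boldsymbol B_{i-\frac12,j}+\boldsymbol B_{i,j+\frac12}+\boldsymbol B_{i,j-\frac12}\big).$$ **Reconstruction.** Let $\overline{\boldsymbol\eta}_{i,j}=\overline{\boldsymbol h}_{i,j}+\overline{\boldsymbol B}_{i,j}$. For each of $w=\boldsymbol\eta,\boldsymbol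 q^x,\boldsymbol q^y$ with cell averages $\overline w_{i,j}$, set $w^{E}_{i,j}=\overline w_{i,j}+\frac{\Delta x}{2}(w_x)_{i,j}$, $w^{W}_{i,j}=\overline w_{i,j}-\frac{\Delta x}{2}(w_x)_{i,j}$, $w^{N}_{i,j}=\overline w_{i,j}+\frac{\Delta y}{2}(w_y)_{i,j}$, $w^{S}_{i,j}=\overline w_{i,j}-\frac{\Delta y}{2}(w_y)_{i,j}$, where, componentwise, with $\theta\in[1,2]$, $$(w_x)_{i,j}=\mathrm{minmod}\Big(\theta\tfrac{\overline w_{i,j}-\overline w_{i-1,j}}{\Delta x},\tfrac{\overline w_{i+1,j}-\overline w_{i-1,j}}{2\Delta x},\theta\tfrac{\overline w_{i+1,j}-\overline w_{i,j}}{\Delta x}\Big),$$ and $(w_y)_{i,j}$ is defined analogously in the $j$ direction with $\Delta y$. Here $\mathrm{minmod}(c_1,\dots,c_n)$ is $\min_j c_j$ if all $c_j>0$, $\max_j c_j$ if all $c_j<0$, and $0$ otherwise. The height point values are $$\boldsymbol h^{W}_{i,j}=\boldsymbol\eta^W_{i,j}-\boldsymbol B_{i-\frac12,j},\quad \boldsymbol h^{E}_{i,j}=\boldsymbol\eta^E_{i,j}-\boldsymbol B_{i+\frac12,j},\quad \boldsymbol h^{S}_{i,j}=\boldsymbol\eta^S_{i,j}-\boldsymbol B_{i,j-\frac12},\quad \boldsymbol h^{N}_{i,j}=\boldsymbol\eta^N_{i,j}-\boldsymbol B_{i,j+\frac12},$$ and $\boldsymbol U^{W,E,S,N}_{i,j}$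 stacks the corresponding $\boldsymbol h,\boldsymbol q^x,\boldsymbol q^y$. Standing assumption: the matrices $\mathcal P(\boldsymbol h^{W,E,S,N}_{i,j})$ are positive definite, so that the system is hyperbolic at the reconstructed values and the speeds below are real. **Numerical fluxes.** With $\lambda_1,\lambda_{3K}$ the smallest and largest eigenvalues, $$a^-_{i+\frac12,j}=\min\{\lambda_1(\tfrac{\partial\widehat F}{\partial\widehat U}(\boldsymbol U^W_{i+1,j})),\lambda_1(\tfrac{\partial\widehat F}{\partial\widehat U}(\boldsymbol U^E_{i,j})),0\},\quad a^+_{i+\frac12,j}=\max\{\lambda_{3K}(\tfrac{\partial\widehat F}{\partial\widehat U}(\boldsymbol U^W_{i+1,j})),\lambda_{3K}(\tfrac{\partial\widehat F}{\partial\widehat U}(\boldsymbol U^E_{i,j})),0\},$$ $$b^-_{i,j+\frac12}=\min\{\lambda_1(\tfrac{\partial\widehat G}{\partial\widehat U}(\boldsymbol U^S_{i,j+1})),\lambda_1(\tfrac{\partial\widehat G}{\partial\widehat U}(\boldsymbol U^N_{i,j})),0\},\quad b^+_{i,j+\frac12}=\max\{\lambda_{3K}(\tfrac{\partial\widehat G}{\partial\widehat U}(\boldsymbol U^S_{i,j+1})),\lambda_{3K}(\tfrac{\partial\widehat G}{\partial\widehat U}(\boldsymbol U^N_{i,j})),0\},$$ and (suppressing the indices on $a^\pm=a^\pm_{i+\frac12,j}$ and $b^\pm=b^\pm_{i,j+\frac12}$) $$\mathcal F_{i+\frac12,j}=\frac{a^+\widehat F(\boldsymbol U^E_{i,j})-a^-\widehat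 F(\boldsymbol U^W_{i+1,j})}{a^+-a^-}+\frac{a^+a^-}{a^+-a^-}\big[\boldsymbol U^W_{i+1,j}-\boldsymbol U^E_{i,j}\big],$$ $$\mathcal G_{i,j+\frac12}=\frac{b^+\widehat G(\boldsymbol U^N_{i,j})-b^-\widehat G(\boldsymbol U^S_{i,j+1})}{b^+-b^-}+\frac{b^+b^-}{b^+-b^-}\big[\boldsymbol U^S_{i,j+1}-\boldsymbol U^N_{i,j}\big].$$ *)

(* Defs.v *)
From HB Require Import structures.
From mathcomp Require Import all_boot all_order all_algebra finmap ring lra.
From mathcomp Require Import all_classical all_reals all_analysis.

Set Implicit Arguments.
Unset Strict Implicit.
Unset Printing Implicit Defensive.

Import Order.TTheory GRing.Theory Num.Theory.
Import numFieldNormedType.Exports.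

Local Open Scope classical_set_scope.
Local Open Scope ring_scope.

(** Lebesgue measure on R^d, realised as d.-tuple R with the product
    sigma-algebra: the iterated product of the one-dimensional measure,
    transported along (x, s) |-> x :: s. *)

Section lebesgue_tuple_step.
Context {R : realType} {n : nat}.
Local Notation T := (n.-tuple (measurableTypeR R)).
Local Notation T' := (n.+1.-tuple (measurableTypeR R)).
Variable m : {sigma_finite_measure set T -> \bar R}.

Definition tuple_cons (p : measurableTypeR R * T) : T' := cons_tuple p.1 p.2.

Lemma measurable_tuple_cons : measurable_fun [set: _] tuple_cons.
Proof. exact: measurable_cons. Qed.

Definition lebesgue_cons : set T' -> \bar R :=
  pushforward (@lebesgue_measure R \x m)%E tuple_cons.

Let preimage_measurable A :
  measurable A -> measurable (tuple_cons @^-1` A).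
Proof. by move=> mA; rewrite -[X in measurable X]setTI; exact: measurable_tuple_cons. Qed.

Let lebesgue_cons0 : lebesgue_cons set0 = 0%E.
Proof. by rewrite /lebesgue_cons /pushforward preimage_set0 measure0. Qed.

Let lebesgue_cons_ge0 A : (0 <= lebesgue_cons A)%E.
Proof. exact: (measure_ge0 (@lebesgue_measure R \x m)%E). Qed.

Let lebesgue_cons_sigma_additive : semi_sigma_additive lebesgue_cons.
Proof.
move=> F mF tF mUF; rewrite /lebesgue_cons /pushforward preimage_bigcup.
apply: measure_semi_sigma_additive.
- by move=> i; exact: preimage_measurable.
- apply/trivIsetP => /= i j _ _ ij; rewrite -preimage_setI.
  by move/trivIsetP : tF => /(_ _ _ _ _ ij) ->//; rewrite preimage_set0.
- by rewrite -preimage_bigcup; exact: preimage_measurable.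
Qed.

HB.instance Definition _ := isMeasure.Build _ _ _ lebesgue_cons
  lebesgue_cons0 lebesgue_cons_ge0 lebesgue_cons_sigma_additive.

Let lebesgue_cons_sigma_finite : sigma_finite setT lebesgue_cons.
Proof.
have /sigma_finiteP[F [FT ndF Foo]] := sigma_finiteT (@lebesgue_measure R).
have /sigma_finiteP[G [GT ndG Goo]] := sigma_finiteT m.
pose uncons (s : T') : measurableTypeR R * T := (thead s, [tuple of behead s]).
have muncons : measurable_fun [set: T'] uncons.
  by apply: measurable_fun_pair => /=;
    [exact: measurable_tnth | exact: measurable_behead].
have consK p : uncons (tuple_cons p) = p.
  by case: p => x s; congr pair; exact: val_inj.
exists (fun i => uncons @^-1` (F i `*` G i)).
  apply/seteqP; split => // s _.
  have [i _ Fi] : (\bigcup_i F i) (uncons s).1 by rewrite -FT.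
  have [j _ Gj] : (\bigcup_j G j) (uncons s).2 by rewrite -GT.
  exists (maxn i j) => //; split.
  - by move: Fi; exact/subsetPset/ndF/leq_maxl.
  - by move: Gj; exact/subsetPset/ndG/leq_maxr.
move=> i; have [mF Fi] := Foo i; have [mG Gi] := Goo i; split.
  by rewrite -[X in measurable X]setTI; apply: muncons => //; exact: measurableX.
rewrite /lebesgue_cons /pushforward.
rewrite [X in (@lebesgue_measure R \x m)%E X](_ : _ = F i `*` G i); last first.
  by apply/funext => p; rewrite /preimage /mkset consK.
by rewrite product_measure1E// lte_mul_pinfty// ge0_fin_numE.
Qed.

HB.instance Definition _ := Measure_isSigmaFinite.Build _ _ _ lebesgue_cons
  lebesgue_cons_sigma_finite.

End lebesgue_tuple_step.

Fixpoint lebesgue_tuple (R : realType) (d : nat) :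
    {sigma_finite_measure set (d.-tuple (measurableTypeR R)) -> \bar R} :=
  match d with
  | 0 => \d_([tuple] : 0.-tuple (measurableTypeR R))
  | d'.+1 => lebesgue_cons (lebesgue_tuple R d')
  end.

Section chaos_basis.
Context {R : realType} {d : nat}.
Local Notation T := (d.-tuple (measurableTypeR R)).
Local Notation mu := (lebesgue_tuple R d).
Implicit Types (rho f : T -> R) (nu : d.-tuple nat).

Definition monomial nu (s : T) : R :=
  \prod_(i < d) (tnth s i : R) ^+ tnth nu i.

Definition is_density rho :=
  [/\ measurable_fun setT rho, forall s, 0 <= rho s &
      (\int[mu]_s (rho s)%:E = 1)%E].

Definition finite_moments rho := forall nu,
  mu.-integrable setT (fun s => (monomial nu s * rho s)%:E).

Definition inner rho (f1 f2 : T -> R) : R :=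
  \int[mu]_s (f1 s * f2 s * rho s).

Definition poly_space (Lam : {fset d.-tuple nat}) : set (T -> R) :=
  [set f | exists c : d.-tuple nat -> R,
     forall s, f s = \sum_(nu <- Lam) c nu * monomial nu s].

Definition orthonormal_basis rho (V : set (T -> R)) K (phi : 'I_K -> T -> R) :=
  [/\ forall k, V (phi k),
      forall f, V f -> exists c : 'I_K -> R,
        forall s, f s = \sum_k c k * phi k s &
      forall k l, inner rho (phi k) (phi l) = (k == l)%:R].

Definition galerkin rho K (phi : 'I_K -> T -> R) (k : 'I_K) : 'M[R]_K :=
  \matrix_(l, m) inner rho (phi k) (fun s => phi l s * phi m s).

End chaos_basis.

(** The Galerkin matrices enter the scheme only through [M]; the theorem takes
    [M := galerkin rho phi]. *)

Section galerkin_system.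
Context {R : realType} {K : nat}.
Variables (M : 'I_K -> 'M[R]_K) (g : R).

Definition Pmx (z : 'cV[R]_K) : 'M[R]_K := \sum_k z k 0 *: M k.

Definition stack (h qx qy : 'cV[R]_K) : 'cV[R]_(K + (K + K)) :=
  col_mx h (col_mx qx qy).

Definition Fhat (U : 'cV[R]_(K + (K + K))) : 'cV[R]_(K + (K + K)) :=
  let h := usubmx U in
  let qx := usubmx (dsubmx U) in
  let qy := dsubmx (dsubmx U) in
  stack qx
    (Pmx qx *m invmx (Pmx h) *m qx + (2^-1 * g) *: (Pmx h *m h))
    (Pmx qx *m invmx (Pmx h) *m qy).

Definition Ghat (U : 'cV[R]_(K + (K + K))) : 'cV[R]_(K + (K + K)) :=
  let h := usubmx U in
  let qx := usubmx (dsubmx U) in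
  let qy := dsubmx (dsubmx U) in
  stack qy
    (Pmx qy *m invmx (Pmx h) *m qx)
    (Pmx qy *m invmx (Pmx h) *m qy + (2^-1 * g) *: (Pmx h *m h)).

End galerkin_system.

Section spectral_data.
Context {R : realType}.

Definition posdef n (A : 'M[R]_n) :=
  A^T = A /\ forall v : 'cV[R]_n, v != 0 -> 0 < (v^T *m A *m v) 0 0.

(** Entry (l, m) is the partial derivative of the l-th component of [f] in the
    m-th coordinate; the library's ['J] is the transpose, for row vectors. *)
Definition jacobian_matrix n (f : 'cV[R]_n -> 'cV[R]_n) (U : 'cV[R]_n) :
    'M[R]_n :=
  \matrix_(l, m) 'D_(delta_mx m 0) (fun V => f V l 0) U.

(** These are the extreme real eigenvalues; at hyperbolic states every
    eigenvalue of the Jacobians is real. *)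
Definition lambda_min n (A : 'M[R]_n) : R := inf [set a | eigenvalue A a].
Definition lambda_max n (A : 'M[R]_n) : R := sup [set a | eigenvalue A a].

End spectral_data.

Definition minmod {R : realType} (c : seq R) : R :=
  if all (fun x => 0 < x) c then \big[Num.min/head 0 c]_(x <- c) x
  else if all (fun x => x < 0) c then \big[Num.max/head 0 c]_(x <- c) x
  else 0.

(** Cells are indexed by int * int.  Half-integer indices are encoded by the
    integer on their left: [xface G i] is x_{i+1/2}, and likewise for every
    face or corner quantity below. *)

Record grid (R : realType) := Grid {
  xorig : R; yorig : R;
  dx : R; dy : R;
  dx_gt0 : 0 < dx; dy_gt0 : 0 < dy }.

Section bottom.
Context {R : realType} {K : nat}.
Variables (G : grid R) (B : R * R -> 'cV[R]_K).

Definition xcenter (i : int) : R := xorig G + i%:~R * dx G.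
Definition ycenter (j : int) : R := yorig G + j%:~R * dy G.
Definition xface (i : int) : R := xcenter i + dx G / 2.
Definition yface (j : int) : R := ycenter j + dy G / 2.

(** The limits are those of B near, but not at, the corner.  An infinite limit
    is read as 0 by [fine]. *)
Definition corner_value (i j : int) : 'cV[R]_K :=
  \col_l ((fine (limf_einf (fun p : R * R => (B p l 0)%:E)
                           (xface i, yface j)^') +
           fine (limf_esup (fun p : R * R => (B p l 0)%:E)
                           (xface i, yface j)^')) / 2).

Definition bilinear_cell (i j : int) (p : R * R) : 'cV[R]_K :=
  let s := (p.1 - xface (i - 1)) / dx G in
  let t := (p.2 - yface (j - 1)) / dy G in
  ((1 - s) * (1 - t)) *: corner_value (i - 1) (j - 1) +
  (s * (1 - t)) *: corner_value i (j - 1) +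
  ((1 - s) * t) *: corner_value (i - 1) j +
  (s * t) *: corner_value i j.

(** On a common face the bilinear functions of both cells agree, so that it
    does not matter to which cell the face is attributed: see [Btilde_cell]. *)
Definition Btilde (p : R * R) : 'cV[R]_K :=
  bilinear_cell (Num.floor ((p.1 - xface (- 1)) / dx G))
                (Num.floor ((p.2 - yface (- 1)) / dy G)) p.

Definition Bxface (i j : int) : 'cV[R]_K := Btilde (xface i, ycenter j).
Definition Byface (i j : int) : 'cV[R]_K := Btilde (xcenter i, yface j).

Definition cell (i j : int) : set (R * R) :=
  `[xface (i - 1), xface i] `*` `[yface (j - 1), yface j].

Definition Bbar (i j : int) : 'cV[R]_K :=
  \col_l ((dx G * dy G)^-1 *
    \int[(@lebesgue_measure R \x @lebesgue_measure R)%E]_(p in cell i j)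
      Btilde p l 0).

End bottom.

Section bottom_cell.
Context {R : realType} {K : nat}.
Variables (G : grid R) (B : R * R -> 'cV[R]_K).

Let floor_cell (d x o : R) (i : int) : 0 < d ->
  o + (i - 1)%:~R * d + d / 2 <= x <= o + i%:~R * d + d / 2 ->
  Num.floor ((x - (o + (- 1)%:~R * d + d / 2)) / d) = i \/
  (x = o + i%:~R * d + d / 2 /\ Num.floor ((x - (o + (- 1)%:~R * d + d / 2)) / d) = i + 1).
Proof.
move=> d0; rewrite intrB => /andP[l u].
have [xe|xn] := eqVneq x (o + i%:~R * d + d / 2).
  right; split => //; apply/eqP; rewrite floor_eq ?num_real// ler_pdivlMr// ltr_pdivrMr//.
  rewrite !intrD; apply/andP; split; nra.
have {}u : x < o + i%:~R * d + d / 2 by rewrite lt_neqAle xn.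
left; apply/eqP; rewrite floor_eq ?num_real// ler_pdivlMr// ltr_pdivrMr// !intrD.
apply/andP; split; nra.
Qed.

Lemma Btilde_cell i j p : cell G i j p -> Btilde G B p = bilinear_cell G B i j p.
Proof.
case: p => x y []; rewrite /= !in_itv/= /Btilde /xface /yface /xcenter /ycenter /= => xi yj.
have dx0 := dx_gt0 G; have dy0 := dy_gt0 G.
have dxn0 := lt0r_neq0 dx0; have dyn0 := lt0r_neq0 dy0.
have ex (k l : int): x = xorig G + k%:~R * dx G + dx G / 2 ->
   bilinear_cell G B (k + 1) l (x, y) = bilinear_cell G B k l (x, y).
  move=> ->; rewrite /bilinear_cell /xface /xcenter /= addrK subrr mul0r.
  rewrite (_ : (_ - _) / dx G = 1); last by rewrite intrB; field.
  by rewrite subrr !(mul0r, subr0, mul1r, scale0r, addr0, add0r).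
have ey (k l : int): y = yorig G + l%:~R * dy G + dy G / 2 ->
   bilinear_cell G B k (l + 1) (x, y) = bilinear_cell G B k l (x, y).
  move=> ->; rewrite /bilinear_cell /yface /ycenter /= addrK subrr mul0r.
  rewrite (_ : (_ - _) / dy G = 1); last by rewrite intrB; field.
  by rewrite subrr !(mulr0, subr0, mulr1, scale0r, addr0, add0r).
case: (@floor_cell _ _ _ _ dx0 xi) => [->|[xe ->]]; case: (@floor_cell _ _ _ _ dy0 yj) => [->|[ye ->]] //;
 by rewrite ?ex ?ey.
Qed.

End bottom_cell.

Record cell_averages (R : realType) (K : nat) := CellAverages {
  havg : int -> int -> 'cV[R]_K;
  qxavg : int -> int -> 'cV[R]_K;
  qyavg : int -> int -> 'cV[R]_K }.

Section scheme.
Context {R : realType} {K : nat}.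
Variables (M : 'I_K -> 'M[R]_K) (g theta : R) (G : grid R).
Variables (B : R * R -> 'cV[R]_K) (A : cell_averages R K).
Implicit Types (w : int -> int -> 'cV[R]_K) (i j : int).

Definition xslope w i j : 'cV[R]_K := \col_l minmod
  [:: theta * ((w i j l 0 - w (i - 1) j l 0) / dx G);
      (w (i + 1) j l 0 - w (i - 1) j l 0) / (2 * dx G);
      theta * ((w (i + 1) j l 0 - w i j l 0) / dx G)].

Definition yslope w i j : 'cV[R]_K := \col_l minmod
  [:: theta * ((w i j l 0 - w i (j - 1) l 0) / dy G);
      (w i (j + 1) l 0 - w i (j - 1) l 0) / (2 * dy G);
      theta * ((w i (j + 1) l 0 - w i j l 0) / dy G)].

Definition recE w i j := w i j + (dx G / 2) *: xslope w i j.
Definition recW w i j := w i j - (dx G / 2) *: xslope w i j.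
Definition recN w i j := w i j + (dy G / 2) *: yslope w i j.
Definition recS w i j := w i j - (dy G / 2) *: yslope w i j.

Definition etaavg i j := havg A i j + Bbar G B i j.

Definition hW i j := recW etaavg i j - Bxface G B (i - 1) j.
Definition hE i j := recE etaavg i j - Bxface G B i j.
Definition hS i j := recS etaavg i j - Byface G B i (j - 1).
Definition hN i j := recN etaavg i j - Byface G B i j.

Definition UW i j := stack (hW i j) (recW (qxavg A) i j) (recW (qyavg A) i j).
Definition UE i j := stack (hE i j) (recE (qxavg A) i j) (recE (qyavg A) i j).
Definition US i j := stack (hS i j) (recS (qxavg A) i j) (recS (qyavg A) i j).
Definition UN i j := stack (hN i j) (recN (qxavg A) i j) (recN (qyavg A) i j).

(** Positive definiteness at the two reconstructed values on either side of the
    face (i+1/2, j), resp. (i, j+1/2). *)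
Definition posdef_xface i j :=
  posdef (Pmx M (hE i j)) /\ posdef (Pmx M (hW (i + 1) j)).
Definition posdef_yface i j :=
  posdef (Pmx M (hN i j)) /\ posdef (Pmx M (hS i (j + 1))).

Local Notation JF := (jacobian_matrix (Fhat M g)).
Local Notation JG := (jacobian_matrix (Ghat M g)).

Definition aminus i j : R :=
  Num.min (Num.min (lambda_min (JF (UW (i + 1) j)))
                   (lambda_min (JF (UE i j)))) 0.
Definition aplus i j : R :=
  Num.max (Num.max (lambda_max (JF (UW (i + 1) j)))
                   (lambda_max (JF (UE i j)))) 0.
Definition bminus i j : R :=
  Num.min (Num.min (lambda_min (JG (US i (j + 1))))
                   (lambda_min (JG (UN i j)))) 0.
Definition bplus i j : R :=
  Num.max (Num.max (lambda_max (JG (US i (j + 1))))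
                   (lambda_max (JG (UN i j)))) 0.

Definition xflux i j : 'cV[R]_(K + (K + K)) :=
  let am := aminus i j in let ap := aplus i j in
  (ap - am)^-1 *: (ap *: Fhat M g (UE i j) - am *: Fhat M g (UW (i + 1) j)) +
  (ap * am / (ap - am)) *: (UW (i + 1) j - UE i j).

Definition yflux i j : 'cV[R]_(K + (K + K)) :=
  let bm := bminus i j in let bp := bplus i j in
  (bp - bm)^-1 *: (bp *: Ghat M g (UN i j) - bm *: Ghat M g (US i (j + 1))) +
  (bp * bm / (bp - bm)) *: (US i (j + 1) - UN i j).

Definition source i j : 'cV[R]_(K + (K + K)) :=
  stack 0
    (- (g *: (Pmx M (havg A i j) *m
              ((dx G)^-1 *: (Bxface G B i j - Bxface G B (i - 1) j)))))
    (- (g *: (Pmx M (havg A i j) *m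
              ((dy G)^-1 *: (Byface G B i j - Byface G B i (j - 1)))))).

Definition scheme_rhs i j : 'cV[R]_(K + (K + K)) :=
  - ((dx G)^-1 *: (xflux i j - xflux (i - 1) j))
  - ((dy G)^-1 *: (yflux i j - yflux i (j - 1))) + source i j.

End scheme.

(** The cells whose averages enter the right-hand side in some cell of [C]:
    those of [C] together with two layers of neighbours in each direction. *)
Definition with_ghosts (C : set (int * int)) : set (int * int) :=
  [set c | exists2 c0, C c0 &
     (c.2 = c0.2 /\ `|c.1 - c0.1| <= 2) \/ (c.1 = c0.1 /\ `|c.2 - c0.2| <= 2)].

Definition lake_at_rest (R : realType) (K : nat) (G : grid R)
    (B : R * R -> 'cV[R]_K) (A : cell_averages R K) (D : set (int * int)) :=
  exists etastar : 'cV[R]_K, forall i j, D (i, j) ->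
    [/\ havg A i j + Bbar G B i j = etastar, qxavg A i j = 0 &
        qyavg A i j = 0].

(* Main.v *)
(** At rest the reconstruction is exact: all slopes vanish and both one-sided
    states at a face equal (eta* - B, 0, 0) with the same face value of B, so the
    central-upwind flux reduces to the flux of that state, whose only nonzero
    part is the hydrostatic pressure g/2 P(h)h.  Since P(a)b = P(b)a, the pressure
    difference factors as P(hE + hW)(hE - hW), and hE + hW is twice the cell
    average of h because the mean of a bilinear function over a cell is its value
    at the centre; this cancels the source term.

    The reduction needs a+ - a- <> 0.  Along the coordinate directions the fluxes
    are quadratic at a state without discharge, which gives the Jacobian there
    without differentiating P(h)^-1.  If v P(h) = a v, then (t v, v, 0) is a left
    eigenvector of the x-Jacobian for t = sqrt (g a) > 0; such a real a > 0 exists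
    because P(h) is symmetric positive definite and K > 0. *)

Require Import Defs.
From mathcomp Require Import all_boot all_order all_algebra finmap zify ring lra.
From mathcomp Require Import all_classical all_reals all_analysis.
From mathcomp Require Import complex measurable_realfun.
From mathcomp Require polyrcf.

Import Order.TTheory GRing.Theory Num.Theory.
Import numFieldNormedType.Exports.

Local Open Scope classical_set_scope.
Local Open Scope ring_scope.

Lemma symmetric_eigenvalue {R : rcfType} {n : nat} (S : 'M[R]_n) :
  (0 < n)%N -> S^T = S -> exists a, eigenvalue S a.
Proof.
move=> n0 symS; pose SC := map_mx (real_complex R) S.
have [a aS] := eigenvalue_closed SC n0.
suff a_real : a^* = a.
  exists (complex.Re a); rewrite -(eigenvalue_map (real_complex R)).
  have ReaE : real_complex R (complex.Re a) = a by apply: RRe_real; apply/CrealP.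
  by rewrite /= ReaE.
have /eigenvalueP[v vS v0] := aS.
pose w := (map_mx Num.conj v)^T.
pose N := (v *m w) 0 0.
have NE : N = \sum_i `|v 0 i| ^+ 2.
  by rewrite /N mxE; apply: eq_bigr => i _; rewrite !mxE normCK.
have N0 : N != 0.
  rewrite NE psumr_neq0; last by move=> i _; rewrite exprn_ge0.
  have /rV0Pn[i vi] := v0; apply/hasP; exists i; first exact: mem_index_enum.
  by rewrite /= exprn_gt0// normr_gt0.
have NC : N^* = N.
  by rewrite NE rmorph_sum; apply: eq_bigr => i _; rewrite rmorphXn/= conj_normC.
have QE : (v *m SC *m w) 0 0 = a * N by rewrite vS -scalemxAl mxE.
have QC : ((v *m SC *m w) 0 0)^* = (v *m SC *m w) 0 0.
  have -> : ((v *m SC *m w) 0 0)^* = (map_mx Num.conj (v *m SC *m w))^T 0 0.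
    by rewrite !mxE.
  rewrite !map_mxM !trmx_mul.
  have -> : (map_mx Num.conj w)^T = v by apply/matrixP => i j; rewrite !mxE conjCK.
  have -> : (map_mx Num.conj SC)^T = SC.
    apply/matrixP => i j; rewrite !mxE -[in RHS]symS mxE.
    by apply/CrealP; rewrite complex_real.
  by rewrite mulmxA.
by move: QC; rewrite QE rmorphM/= NC => /(mulIf N0).
Qed.

Lemma posdef_eigenvalue_gt0 {R : realType} {n : nat} (S : 'M[R]_n) a :
  posdef S -> eigenvalue S a -> 0 < a.
Proof.
move=> [_ pS] /eigenvalueP[v vS v0].
have vT0 : v^T != 0 by rewrite trmx_eq0.
have := pS _ vT0; rewrite trmxK vS -scalemxAl mxE.
have vv : 0 <= (v *m v^T) 0 0.
  by rewrite mxE; apply: sumr_ge0 => i _; rewrite mxE -expr2 sqr_ge0.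
rewrite pmulr_lgt0// lt_neqAle vv andbT.
apply: contraTneq (pS _ vT0) => h.
by rewrite trmxK vS -scalemxAl mxE -h mulr0 ltxx.
Qed.

Lemma lambda_max_ge {R : realType} {n : nat} (S : 'M[R]_n) a :
  eigenvalue S a -> a <= lambda_max S.
Proof.
move=> aS; apply: ub_le_sup => //.
have p0 : char_poly S != 0 by rewrite monic_neq0// char_poly_monic.
exists (polyrcf.cauchy_bound (char_poly S)) => b /=.
rewrite eigenvalue_root_char leNgt => rb; apply/negP => lt_b.
by have := @polyrcf.ge_cauchy_bound _ _ p0 b; rewrite in_itv/= ltW// rb => /(_ isT).
Qed.

Lemma jacobian_matrix_quadratic {R : realType} {n : nat}
    (f : 'cV[R]_n -> 'cV[R]_n) (U : 'cV[R]_n) (J : 'M[R]_n) :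
  (forall m, exists c : 'cV[R]_n, forall s : R,
     f (s *: delta_mx m 0 + U) =
       f U + s *: (J *m delta_mx m 0) + s ^+ 2 *: c) ->
  jacobian_matrix f U = J.
Proof.
move=> fE; apply/matrixP => l m; rewrite mxE /derive.
have [c {}fE] := fE m.
apply: cvg_lim => //.
have lin : (fun s : R => J l m + s * c l 0) @ 0^' --> J l m.
  rewrite -[X in _ --> X]addr0 -[X in _ + X](mul0r (c l 0)).
  apply: cvgD; first exact: cvg_cst.
  apply: cvgM; last exact: cvg_cst.
  exact: cvg_within.
apply: cvg_trans lin; apply: near_eq_cvg; near=> s.
have s0 : s != 0 by near: s; exact: nbhs_dnbhs_neq.
by rewrite /= fE -colE !mxE /GRing.scale/=; field.
Unshelve. all: by end_near.
Qed.

Section still_water.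
Context {R : realType} {K : nat}.
Variables (M : 'I_K -> 'M[R]_K) (g : R).
Hypothesis Msym : forall k l m, M k l m = M m l k.
Implicit Types a b h : 'cV[R]_K.

Lemma Pmx_mulC a b : Pmx M a *m b = Pmx M b *m a.
Proof.
apply/colP => l; rewrite !mxE.
under eq_bigr do rewrite summxE mulr_suml.
rewrite exchange_big; apply: eq_bigr => k _; rewrite summxE mulr_suml.
by apply: eq_bigr => m _; rewrite !mxE Msym; ring.
Qed.

Lemma PmxD a b : Pmx M (a + b) = Pmx M a + Pmx M b.
Proof.
by rewrite /Pmx -big_split; apply: eq_bigr => k _; rewrite mxE scalerDl.
Qed.

Lemma PmxZ s a : Pmx M (s *: a) = s *: Pmx M a.
Proof.
by rewrite /Pmx scaler_sumr; apply: eq_bigr => k _; rewrite mxE scalerA.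
Qed.

Lemma Pmx0 : Pmx M 0 = 0.
Proof. by rewrite -(scale0r 0) PmxZ scale0r. Qed.

Lemma Pmx_sqrB a b : Pmx M a *m a - Pmx M b *m b = Pmx M (a + b) *m (a - b).
Proof.
rewrite PmxD mulmxDl !mulmxBr (Pmx_mulC b a) addrA subrK//.
Qed.

Lemma FhatE h qx qy : Fhat M g (stack h qx qy) =
  stack qx
    (Pmx M qx *m invmx (Pmx M h) *m qx + (2^-1 * g) *: (Pmx M h *m h))
    (Pmx M qx *m invmx (Pmx M h) *m qy).
Proof. by rewrite /Fhat /stack !(col_mxKu, col_mxKd). Qed.

Lemma GhatE h qx qy : Ghat M g (stack h qx qy) =
  stack qy
    (Pmx M qy *m invmx (Pmx M h) *m qx)
    (Pmx M qy *m invmx (Pmx M h) *m qy + (2^-1 * g) *: (Pmx M h *m h)).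
Proof. by rewrite /Ghat /stack !(col_mxKu, col_mxKd). Qed.

Lemma Fhat_rest h :
  Fhat M g (stack h 0 0) = stack 0 ((2^-1 * g) *: (Pmx M h *m h)) 0.
Proof. by rewrite FhatE mulmx0 add0r. Qed.

Lemma Ghat_rest h :
  Ghat M g (stack h 0 0) = stack 0 0 ((2^-1 * g) *: (Pmx M h *m h)).
Proof. by rewrite GhatE mulmx0 add0r. Qed.

Lemma stackD h1 x1 y1 h2 x2 y2 :
  stack h1 x1 y1 + stack h2 x2 y2 = stack (h1 + h2) (x1 + x2) (y1 + y2) :> 'cV[R]__.
Proof. by rewrite /stack !add_col_mx. Qed.

Lemma stackZ s h x y : s *: stack h x y = stack (s *: h) (s *: x) (s *: y) :> 'cV[R]__.
Proof. by rewrite /stack !scale_col_mx. Qed.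

Lemma stackN h x y : - stack h x y = stack (- h) (- x) (- y) :> 'cV[R]__.
Proof. by rewrite /stack !opp_col_mx. Qed.

Variant stack_delta_spec : 'cV[R]_(K + (K + K)) -> Prop :=
| StackDeltaH e : stack_delta_spec (stack e 0 0)
| StackDeltaX e : stack_delta_spec (stack 0 e 0)
| StackDeltaY e : stack_delta_spec (stack 0 0 e).

Lemma stack_deltaP m : stack_delta_spec (delta_mx m 0).
Proof.
rewrite -[m]splitK; case: (fintype.split m) => /= k.
  have -> : delta_mx (lshift _ k) 0 = stack (delta_mx k 0) 0 0 :> 'cV[R]__.
    by rewrite /stack col_mx0 -delta_mx_ushift.
  by constructor.
rewrite -[k]splitK; case: (fintype.split k) => /= {}k.
  have -> : delta_mx (rshift _ (lshift _ k)) 0 = stack 0 (delta_mx k 0) 0 :> 'cV[R]__.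
    by rewrite /stack -delta_mx_ushift -delta_mx_dshift.
  by constructor.
have -> : delta_mx (rshift _ (rshift _ k)) 0 = stack 0 0 (delta_mx k 0) :> 'cV[R]__.
  by rewrite /stack -!delta_mx_dshift.
by constructor.
Qed.

Definition xjacobian_rest h : 'M[R]_(K + (K + K)) :=
  block_mx 0 (row_mx 1%:M 0) (col_mx (g *: Pmx M h) 0) 0.

Definition yjacobian_rest h : 'M[R]_(K + (K + K)) :=
  block_mx 0 (row_mx 0 1%:M) (col_mx 0 (g *: Pmx M h)) 0.

Lemma xjacobian_rest_mul h a x y :
  xjacobian_rest h *m stack a x y = stack x (g *: (Pmx M h *m a)) 0.
Proof.
rewrite /xjacobian_rest /stack mul_block_col mul_row_col mul_col_mx !mul0mx.
by rewrite mul1mx add0r !addr0 scalemxAl.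
Qed.

Lemma yjacobian_rest_mul h a x y :
  yjacobian_rest h *m stack a x y = stack y 0 (g *: (Pmx M h *m a)).
Proof.
rewrite /yjacobian_rest /stack mul_block_col mul_row_col mul_col_mx !mul0mx.
by rewrite mul1mx !add0r addr0 scalemxAl.
Qed.

Lemma Pmx_sqrD a b s : (2^-1 * g) *: (Pmx M (s *: a + b) *m (s *: a + b)) =
  (2^-1 * g) *: (Pmx M b *m b) + s *: (g *: (Pmx M b *m a)) +
  s ^+ 2 *: ((2^-1 * g) *: (Pmx M a *m a)).
Proof.
rewrite PmxD PmxZ mulmxDl !mulmxDr -!scalemxAl -!scalemxAr (Pmx_mulC a b).
by apply/colP => l; rewrite !mxE; field.
Qed.

Lemma jacobian_Fhat_rest h :
  jacobian_matrix (Fhat M g) (stack h 0 0) = xjacobian_rest h.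
Proof.
apply: jacobian_matrix_quadratic => m; case: (stack_deltaP m) => e.
- exists (stack 0 ((2^-1 * g) *: (Pmx M e *m e)) 0) => s.
  rewrite xjacobian_rest_mul !stackZ stackD !FhatE !stackD.
  rewrite !scaler0 !addr0 Pmx0 !mul0mx Pmx_sqrD.
  by rewrite !add0r.
- exists (stack 0 (Pmx M e *m invmx (Pmx M h) *m e) 0) => s.
  rewrite xjacobian_rest_mul !stackZ stackD !FhatE !stackD.
  rewrite !scaler0 !(addr0, add0r) Pmx0 !mul0mx !mulmx0 !scaler0 !(addr0, add0r).
  rewrite PmxZ -!(scalemxAl, scalemxAr) scalerA -expr2.
  by rewrite addrC.
- exists 0 => s.
  rewrite xjacobian_rest_mul !stackZ stackD !FhatE !stackD.
  by rewrite !scaler0 !(addr0, add0r) Pmx0 !mul0mx !mulmx0 !scaler0 !(addr0, add0r).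
Qed.

Lemma jacobian_Ghat_rest h :
  jacobian_matrix (Ghat M g) (stack h 0 0) = yjacobian_rest h.
Proof.
apply: jacobian_matrix_quadratic => m; case: (stack_deltaP m) => e.
- exists (stack 0 0 ((2^-1 * g) *: (Pmx M e *m e))) => s.
  rewrite yjacobian_rest_mul !stackZ stackD !GhatE !stackD.
  rewrite !scaler0 !addr0 Pmx0 !mul0mx Pmx_sqrD.
  by rewrite !add0r.
- exists 0 => s.
  rewrite yjacobian_rest_mul !stackZ stackD !GhatE !stackD.
  by rewrite !scaler0 !(addr0, add0r) Pmx0 !mul0mx !mulmx0 !scaler0 !(addr0, add0r).
- exists (stack 0 0 (Pmx M e *m invmx (Pmx M h) *m e)) => s.
  rewrite yjacobian_rest_mul !stackZ stackD !GhatE !stackD.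
  rewrite !scaler0 !(addr0, add0r) Pmx0 !mul0mx !mulmx0 !scaler0 !(addr0, add0r).
  rewrite PmxZ -!(scalemxAl, scalemxAr) scalerA -expr2.
  by rewrite addrC.
Qed.

Hypotheses (K_gt0 : (0 < K)%N) (g_gt0 : 0 < g).

Lemma posdef_row_eigenvector h : posdef (Pmx M h) ->
  exists (v : 'rV[R]_K) (t : R),
    [/\ v != 0, 0 < t & v *m (g *: Pmx M h) = t ^+ 2 *: v].
Proof.
move=> pP; have [a aP] := symmetric_eigenvalue _ K_gt0 pP.1.
have a0 := posdef_eigenvalue_gt0 _ _ pP aP.
have /eigenvalueP[v vP v0] := aP; have ga : 0 < g * a by rewrite mulr_gt0.
exists v, (Num.sqrt (g * a)); split => //; first by rewrite sqrtr_gt0.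
by rewrite sqr_sqrtr ?ltW// -scalemxAr vP scalerA.
Qed.

Lemma lambda_max_Fhat_rest_gt0 h : posdef (Pmx M h) ->
  0 < lambda_max (jacobian_matrix (Fhat M g) (stack h 0 0)).
Proof.
move=> /posdef_row_eigenvector[v [t [v0 t0 vP]]].
rewrite (lt_le_trans t0)// lambda_max_ge// jacobian_Fhat_rest.
apply/eigenvalueP; exists (row_mx (t *: v) (row_mx v 0)); last first.
  by apply: contra_neq v0; rewrite -!row_mx0 => /eq_row_mx[_ /eq_row_mx[]].
rewrite /xjacobian_rest mul_row_block mul_row_col mul_mx_row !mulmx0.
by rewrite vP mulmx1 !(add0r, addr0) !scale_row_mx scaler0 scalerA -expr2.
Qed.

Lemma lambda_max_Ghat_rest_gt0 h : posdef (Pmx M h) ->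
  0 < lambda_max (jacobian_matrix (Ghat M g) (stack h 0 0)).
Proof.
move=> /posdef_row_eigenvector[v [t [v0 t0 vP]]].
rewrite (lt_le_trans t0)// lambda_max_ge// jacobian_Ghat_rest.
apply/eigenvalueP; exists (row_mx (t *: v) (row_mx 0 v)); last first.
  by apply: contra_neq v0; rewrite -!row_mx0 => /eq_row_mx[_ /eq_row_mx[]].
rewrite /yjacobian_rest mul_row_block mul_row_col mul_mx_row !mulmx0.
by rewrite vP mulmx1 !(add0r, addr0) !scale_row_mx scaler0 scalerA -expr2.
Qed.

End still_water.

Section product_integral.
Context {d1 d2 : measure_display} {T1 : measurableType d1}
  {T2 : measurableType d2} {R : realType}.
Variables (m1 : {sigma_finite_measure set T1 -> \bar R})
  (m2 : {sigma_finite_measure set T2 -> \bar R}).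

Let integrable_prodT (f : T1 -> R) (g : T2 -> R) :
  m1.-integrable setT (EFin \o f) -> m2.-integrable setT (EFin \o g) ->
  (m1 \x m2)%E.-integrable setT (fun p => (f p.1 * g p.2)%:E).
Proof.
move=> intf intg.
have mf : measurable_fun setT f by apply/measurable_EFinP; exact: measurable_int intf.
have mg : measurable_fun setT g by apply/measurable_EFinP; exact: measurable_int intg.
apply/integrable12ltyP.
  apply/measurable_EFinP; apply: measurable_funM; apply: measurableT_comp => //.
have [_ foo] := integrableP _ _ _ intf; have [_ goo] := integrableP _ _ _ intg.
under eq_integral => x _.
  under eq_integral => y _ do rewrite /= normrM EFinM.
  rewrite ge0_integralZl_EFin//; last first.
    by apply/measurable_EFinP; exact: measurableT_comp.
  over.
rewrite ge0_integralZr//.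
- rewrite lte_mul_pinfty// ?integral_ge0//.
  by rewrite ge0_fin_numE ?integral_ge0.
- by apply/measurable_EFinP; exact: measurableT_comp.
- exact: integral_ge0.
Qed.

Let Rintegral_prodT (f : T1 -> R) (g : T2 -> R) :
  m1.-integrable setT (EFin \o f) -> m2.-integrable setT (EFin \o g) ->
  \int[(m1 \x m2)%E]_p (f p.1 * g p.2) = \int[m1]_x f x * \int[m2]_y g y.
Proof.
move=> intf intg.
rewrite /Rintegral -integral12_prod_meas1; last exact: integrable_prodT.
rewrite /fubini_F/=.
under eq_integral => x _.
  under eq_integral => y _ do rewrite /= EFinM.
  rewrite integralZl//.
  over.
have gfin : (\int[m2]_y (g y)%:E)%E \is a fin_num by exact: integrable_fin_num.
rewrite -(fineK gfin) integralZr// fineM//.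
exact: integrable_fin_num.
Qed.

Variables (D : set T1) (E : set T2).
Hypotheses (mD : measurable D) (mE : measurable E).

Let patch_prod (f : T1 -> R) (g : T2 -> R) p :
  ((fun q => f q.1 * g q.2) \_ (D `*` E)) p = (f \_ D) p.1 * (g \_ E) p.2.
Proof.
rewrite !patchE in_setX.
by case: (p.1 \in D); case: (p.2 \in E); rewrite ?(mul0r, mulr0).
Qed.

Let integrable_patch d (T : measurableType d) (m : {measure set T -> \bar R})
    (A : set T) (f : T -> R) : measurable A ->
  m.-integrable A (EFin \o f) <-> m.-integrable setT (EFin \o (f \_ A)).
Proof. by move=> mA; rewrite integrable_mkcond// restrict_EFin. Qed.

Lemma integrable_prod (f : T1 -> R) (g : T2 -> R) :
  m1.-integrable D (EFin \o f) -> m2.-integrable E (EFin \o g) ->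
  (m1 \x m2)%E.-integrable (D `*` E) (fun p => (f p.1 * g p.2)%:E).
Proof.
move=> /(integrable_patch _ _ _ _ _ mD) intf /(integrable_patch _ _ _ _ _ mE) intg.
apply/integrable_patch; first exact: measurableX.
apply: eq_integrable (integrable_prodT _ _ intf intg) => //= p _.
by rewrite -patch_prod.
Qed.

Lemma Rintegral_prod (f : T1 -> R) (g : T2 -> R) :
  m1.-integrable D (EFin \o f) -> m2.-integrable E (EFin \o g) ->
  \int[(m1 \x m2)%E]_(p in D `*` E) (f p.1 * g p.2) =
  \int[m1]_(x in D) f x * \int[m2]_(y in E) g y.
Proof.
move=> /(integrable_patch _ _ _ _ _ mD) intf /(integrable_patch _ _ _ _ _ mE) intg.
rewrite [LHS]Rintegral_mkcond [X in _ = X * _]Rintegral_mkcond.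
rewrite [X in _ = _ * X]Rintegral_mkcond -Rintegral_prodT//.
by apply: eq_Rintegral => p _; rewrite patch_prod.
Qed.

End product_integral.

Section affine_integral.
Context {R : realType}.
Local Notation mu := (@lebesgue_measure R).

Let continuous_affine (p q : R) : continuous (fun x => p + q * x).
Proof.
move=> x; apply: cvgD; first exact: cvg_cst.
by apply: cvgM; [exact: cvg_cst | exact: cvg_id].
Qed.

Lemma integrable_affine (a b p q : R) :
  mu.-integrable `[a, b] (EFin \o (fun x : R => p + q * x)).
Proof.
apply: continuous_compact_integrable; first exact: segment_compact.
exact/continuous_subspaceT/continuous_affine.
Qed.

Lemma Rintegral_affine (a b p q : R) : a < b ->
  \int[mu]_(x in `[a, b]) (p + q * x) = (b - a) * (p + q * (a + b) / 2).
Proof.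
move=> ab; pose F x := p * x + q / 2 * x ^+ 2.
have dF (x : R) : is_derive x (1 : R) F (p + q * x).
  by rewrite /F; apply: is_derive_eq; rewrite /GRing.scale/=; field.
have cF (y : R) : {for y, continuous F}.
  by apply/differentiable_continuous/derivable1_diffP.
rewrite /Rintegral (@continuous_FTC2 _ _ F)//.
- by rewrite -EFinB /= /F; field.
- exact/continuous_subspaceT/continuous_affine.
- split=> [x _//||]; [exact/cvg_at_right_filter/cF|exact/cvg_at_left_filter/cF].
- by move=> x _; rewrite derive1E derive_val.
Qed.

End affine_integral.

Lemma Rintegral_bilinear {R : realType} (a b c d p q r s : R) :
  a < b -> c < d ->
  \int[(@lebesgue_measure R \x @lebesgue_measure R)%E]_(z in
      `[a, b] `*` `[c, d]) ((p + q * z.1) + (r + s * z.1) * z.2) =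
  (b - a) * (d - c) *
    ((p + q * ((a + b) / 2)) + (r + s * ((a + b) / 2)) * ((c + d) / 2)).
Proof.
move=> ab cd.
under eq_Rintegral => z _.
  rewrite -[p + _]mulr1 -[X in _ * X + _](addr0 1) -(mul0r z.2).
  rewrite -[X in _ * _ + _ * X]mul1r -[X in _ * _ + _ * X]add0r.
  over.
have [mI mJ] := (measurable_itv `[a, b], measurable_itv `[c, d]).
have int2 (k m k' m' : R) := integrable_prod lebesgue_measure lebesgue_measure
  _ _ mI mJ _ _ (integrable_affine a b k m) (integrable_affine c d k' m').
have Rint2 (k m k' m' : R) := Rintegral_prod lebesgue_measure lebesgue_measure
  _ _ mI mJ _ _ (integrable_affine a b k m) (integrable_affine c d k' m').
rewrite RintegralD//; [|exact: measurableX|exact: int2|exact: int2].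
rewrite [X in X + _]Rint2 [X in _ + X]Rint2.
by rewrite !Rintegral_affine//; field.
Qed.

Section bottom_average.
Context {R : realType} {K : nat}.
Variables (G : grid R) (B : R * R -> 'cV[R]_K).

Lemma bilinear_cellE i j p l :
  let s := (p.1 - xface G (i - 1)) / dx G in
  let t := (p.2 - yface G (j - 1)) / dy G in
  bilinear_cell G B i j p l 0 =
    (1 - s) * (1 - t) * corner_value G B (i - 1) (j - 1) l 0 +
    s * (1 - t) * corner_value G B i (j - 1) l 0 +
    (1 - s) * t * corner_value G B (i - 1) j l 0 +
    s * t * corner_value G B i j l 0.
Proof.
rewrite /bilinear_cell; move: (corner_value G B i j) (corner_value G B i (j - 1)).
move: (corner_value G B (i - 1) j) (corner_value G B (i - 1) (j - 1)).
by move=> c01 c00 c11 c10; rewrite !mxE.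
Qed.

Lemma Bbar_center i j :
  Bbar G B i j = bilinear_cell G B i j (xcenter G i, ycenter G j).
Proof.
have dx0 := dx_gt0 G; have dy0 := dy_gt0 G.
have dxn0 := lt0r_neq0 dx0; have dyn0 := lt0r_neq0 dy0.
apply/colP => l; rewrite [LHS]mxE.
pose a := xface G (i - 1); pose c := yface G (j - 1).
pose p00 := corner_value G B (i - 1) (j - 1) l 0.
pose p10 := corner_value G B i (j - 1) l 0.
pose p01 := corner_value G B (i - 1) j l 0.
pose p11 := corner_value G B i j l 0.
pose X (u v : R) := u - (v - u) / dx G * a.
pose Y (u v : R) := (v - u) / dx G.
transitivity ((dx G * dy G)^-1 *
  \int[(@lebesgue_measure R \x @lebesgue_measure R)%E]_(z in cell G i j)
    (((X p00 p10 - (X p01 p11 - X p00 p10) / dy G * c) +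
      (Y p00 p10 - (Y p01 p11 - Y p00 p10) / dy G * c) * z.1) +
     ((X p01 p11 - X p00 p10) / dy G +
      (Y p01 p11 - Y p00 p10) / dy G * z.1) * z.2)).
  congr (_ * _); apply: eq_Rintegral => z; rewrite inE => /Btilde_cell ->.
  rewrite bilinear_cellE -/p00 -/p10 -/p01 -/p11 -/a -/c /X /Y.
  by field; apply/andP.
rewrite Rintegral_bilinear; last 2 first.
- by rewrite /xface /xcenter intrB; nra.
- by rewrite /yface /ycenter intrB; nra.
rewrite bilinear_cellE -/p00 -/p10 -/p01 -/p11 /X /Y /a /c.
rewrite /xface /yface /xcenter /ycenter !intrB /=.
by field; apply/andP.
Qed.

Lemma Bbar_xface i j :
  Bbar G B i j = 2^-1 *: (Bxface G B i j + Bxface G B (i - 1) j).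
Proof.
have dx0 := dx_gt0 G; have dy0 := dy_gt0 G.
have dxn0 := lt0r_neq0 dx0; have dyn0 := lt0r_neq0 dy0.
rewrite /Bxface !(@Btilde_cell _ _ _ _ i j).
- rewrite Bbar_center; apply/colP => l; rewrite [RHS]mxE [X in _ = _ * X]mxE !bilinear_cellE.
  rewrite /xface /yface /xcenter /ycenter !intrB /=.
  by field; apply/andP.
- by split; rewrite /= in_itv/= /xface /yface /xcenter /ycenter !intrB; apply/andP; split; nra.
- by split; rewrite /= in_itv/= /xface /yface /xcenter /ycenter !intrB; apply/andP; split; nra.
Qed.

Lemma Bbar_yface i j :
  Bbar G B i j = 2^-1 *: (Byface G B i j + Byface G B i (j - 1)).
Proof.
have dx0 := dx_gt0 G; have dy0 := dy_gt0 G.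
have dxn0 := lt0r_neq0 dx0; have dyn0 := lt0r_neq0 dy0.
rewrite /Byface !(@Btilde_cell _ _ _ _ i j).
- rewrite Bbar_center; apply/colP => l; rewrite [RHS]mxE [X in _ = _ * X]mxE !bilinear_cellE.
  rewrite /xface /yface /xcenter /ycenter !intrB /=.
  by field; apply/andP.
- by split; rewrite /= in_itv/= /xface /yface /xcenter /ycenter !intrB; apply/andP; split; nra.
- by split; rewrite /= in_itv/= /xface /yface /xcenter /ycenter !intrB; apply/andP; split; nra.
Qed.

End bottom_average.

Lemma minmod_nseq0 {R : realType} n : minmod (nseq n (0 : R)) = 0.
Proof. by case: n => [|n]; rewrite /minmod/= ?big_nil// ltxx. Qed.

Section lake_at_rest_fluxes.
Context {R : realType} {K : nat}.
Variables (theta : R) (G : grid R).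
Implicit Types (w : int -> int -> 'cV[R]_K) (c : 'cV[R]_K).

Lemma xslope_const w i j c :
  w (i - 1) j = c -> w i j = c -> w (i + 1) j = c -> xslope theta G w i j = 0.
Proof.
move=> wl wm wr; apply/colP => l; rewrite !mxE wl wm wr subrr !mul0r mulr0.
exact: minmod_nseq0 3.
Qed.

Lemma yslope_const w i j c :
  w i (j - 1) = c -> w i j = c -> w i (j + 1) = c -> yslope theta G w i j = 0.
Proof.
move=> wl wm wr; apply/colP => l; rewrite !mxE wl wm wr subrr !mul0r mulr0.
exact: minmod_nseq0 3.
Qed.

Lemma central_upwind_same n (ap am : R) (f U : 'cV[R]_n) : am < ap ->
  (ap - am)^-1 *: (ap *: f - am *: f) + (ap * am / (ap - am)) *: (U - U) = f.
Proof.
move=> lt_a; rewrite subrr scaler0 addr0 -scalerBl scalerA mulVf ?scale1r//.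
by rewrite subr_eq0 gt_eqF.
Qed.

Variables (M : 'I_K -> 'M[R]_K) (g : R) (B : R * R -> 'cV[R]_K).
Variables (A : cell_averages R K) (eta : 'cV[R]_K).
Hypothesis Msym : forall k l m, M k l m = M m l k.
Hypotheses (K_gt0 : (0 < K)%N) (g_gt0 : 0 < g).

Definition at_rest i j :=
  [/\ etaavg G B A i j = eta, qxavg A i j = 0 & qyavg A i j = 0].

Lemma xflux_rest i j : (forall k, i - 1 <= k <= i + 2 -> at_rest k j) ->
  posdef_xface M theta G B A i j ->
  xflux M g theta G B A i j = Fhat M g (stack (eta - Bxface G B i j) 0 0).
Proof.
move=> rest [pE _].
have [e0 x0 y0] : at_rest (i - 1) j by apply: rest; lia.
have [e1 x1 y1] : at_rest i j by apply: rest; lia.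
have [e2 x2 y2] : at_rest (i + 1) j by apply: rest; lia.
have [e3 x3 y3] : at_rest (i + 1 + 1) j by apply: rest; lia.
have hEE : hE theta G B A i j = eta - Bxface G B i j.
  by rewrite /hE /recE (xslope_const _ _ _ eta)// e1 scaler0 addr0.
have UEE : UE theta G B A i j = stack (eta - Bxface G B i j) 0 0.
  by rewrite /UE hEE /recE !(xslope_const _ _ _ 0)// x1 y1 scaler0 addr0.
have UWE : UW theta G B A (i + 1) j = stack (eta - Bxface G B i j) 0 0.
  rewrite /UW /hW /recW (xslope_const _ _ _ eta) ?addrK//.
  have [qx0 qy0] : xslope theta G (qxavg A) (i + 1) j = 0 /\
                   xslope theta G (qyavg A) (i + 1) j = 0.
    by split; apply: (xslope_const _ _ _ 0); rewrite ?addrK.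
  by rewrite qx0 qy0 e2 x2 y2 scaler0 !subr0.
rewrite /xflux UEE UWE; apply: central_upwind_same.
rewrite /aminus /aplus UEE UWE (@le_lt_trans _ _ 0) ?ge_min ?lexx ?orbT//.
by rewrite !lt_max lambda_max_Fhat_rest_gt0// -hEE.
Qed.

Lemma yflux_rest i j : (forall k, j - 1 <= k <= j + 2 -> at_rest i k) ->
  posdef_yface M theta G B A i j ->
  yflux M g theta G B A i j = Ghat M g (stack (eta - Byface G B i j) 0 0).
Proof.
move=> rest [pN _].
have [e0 x0 y0] : at_rest i (j - 1) by apply: rest; lia.
have [e1 x1 y1] : at_rest i j by apply: rest; lia.
have [e2 x2 y2] : at_rest i (j + 1) by apply: rest; lia.
have [e3 x3 y3] : at_rest i (j + 1 + 1) by apply: rest; lia.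
have hNE : hN theta G B A i j = eta - Byface G B i j.
  by rewrite /hN /recN (yslope_const _ _ _ eta)// e1 scaler0 addr0.
have UNE : UN theta G B A i j = stack (eta - Byface G B i j) 0 0.
  by rewrite /UN hNE /recN !(yslope_const _ _ _ 0)// x1 y1 scaler0 addr0.
have USE : US theta G B A i (j + 1) = stack (eta - Byface G B i j) 0 0.
  rewrite /US /hS /recS (yslope_const _ _ _ eta) ?addrK//.
  have [qx0 qy0] : yslope theta G (qxavg A) i (j + 1) = 0 /\
                   yslope theta G (qyavg A) i (j + 1) = 0.
    by split; apply: (yslope_const _ _ _ 0); rewrite ?addrK.
  by rewrite qx0 qy0 e2 x2 y2 scaler0 !subr0.
rewrite /yflux UNE USE; apply: central_upwind_same.
rewrite /bminus /bplus UNE USE (@le_lt_trans _ _ 0) ?ge_min ?lexx ?orbT//.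
by rewrite !lt_max lambda_max_Ghat_rest_gt0// -hNE.
Qed.

Lemma hydrostatic_balance (h b b1 b2 : 'cV[R]_K) (e : R) :
  h + b = eta -> b = 2^-1 *: (b2 + b1) ->
  - (e *: ((2^-1 * g) *: (Pmx M (eta - b2) *m (eta - b2)) -
              (2^-1 * g) *: (Pmx M (eta - b1) *m (eta - b1)))) -
  g *: (Pmx M h *m (e *: (b2 - b1))) = 0.
Proof.
move=> hb bE; rewrite -scalerBr (Pmx_sqrB _ Msym).
have -> : (eta - b2) + (eta - b1) = 2 *: h.
  by rewrite -hb bE; apply/colP => l; rewrite !mxE; field.
have -> : (eta - b2) - (eta - b1) = - (b2 - b1).
  by apply/colP => l; rewrite !mxE; ring.
rewrite PmxZ mulmxN -scalemxAl -scalemxAr; move: (Pmx M h *m _) => v.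
by apply/colP => l; rewrite !mxE; field.
Qed.

Lemma flux_source_balance (h b bE bW bN bS : 'cV[R]_K) (e f : R) :
  h + b = eta -> b = 2^-1 *: (bE + bW) -> b = 2^-1 *: (bN + bS) ->
  - (e *: (Fhat M g (stack (eta - bE) 0 0) - Fhat M g (stack (eta - bW) 0 0)))
  - (f *: (Ghat M g (stack (eta - bN) 0 0) - Ghat M g (stack (eta - bS) 0 0)))
  + stack 0 (- (g *: (Pmx M h *m (e *: (bE - bW)))))
            (- (g *: (Pmx M h *m (f *: (bN - bS))))) = 0.
Proof.
move=> hb /(hydrostatic_balance _ _ _ _ e hb) balx.
move=> /(hydrostatic_balance _ _ _ _ f hb) baly.
rewrite !Fhat_rest !Ghat_rest !stackN !stackD !stackZ !stackN !stackD.
rewrite !(subr0, scaler0, addr0, add0r, oppr0) balx baly.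
by rewrite /stack !col_mx0.
Qed.

Lemma scheme_rhs_rest i j :
  (forall k, i - 2 <= k <= i + 2 -> at_rest k j) ->
  (forall k, j - 2 <= k <= j + 2 -> at_rest i k) ->
  [/\ posdef_xface M theta G B A (i - 1) j, posdef_xface M theta G B A i j,
      posdef_yface M theta G B A i (j - 1) & posdef_yface M theta G B A i j] ->
  scheme_rhs M g theta G B A i j = 0.
Proof.
move=> restx resty [pW pE pS pN].
have [hb _ _] : at_rest i j by apply: restx; lia.
have xE : xflux M g theta G B A i j =
    Fhat M g (stack (eta - Bxface G B i j) 0 0).
  by apply: xflux_rest => // k kb; apply: restx; lia.
have xW : xflux M g theta G B A (i - 1) j =
    Fhat M g (stack (eta - Bxface G B (i - 1) j) 0 0).
  by apply: xflux_rest => // k kb; apply: restx; lia.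
have yN : yflux M g theta G B A i j =
    Ghat M g (stack (eta - Byface G B i j) 0 0).
  by apply: yflux_rest => // k kb; apply: resty; lia.
have yS : yflux M g theta G B A i (j - 1) =
    Ghat M g (stack (eta - Byface G B i (j - 1)) 0 0).
  by apply: yflux_rest => // k kb; apply: resty; lia.
rewrite /scheme_rhs xE xW yN yS.
exact: flux_source_balance hb (Bbar_xface G B i j) (Bbar_yface G B i j).
Qed.

End lake_at_rest_fluxes.

Lemma galerkin_sym {R : realType} {d K : nat}
    (rho : d.-tuple (measurableTypeR R) -> R)
    (phi : 'I_K -> d.-tuple (measurableTypeR R) -> R) k l m :
  galerkin rho phi k l m = galerkin rho phi m l k.
Proof. by rewrite !mxE; apply: eq_Rintegral => s _; ring. Qed.

Theorem proposition4p1
  (R : realType) (d K : nat)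
  (rho : d.-tuple (measurableTypeR R) -> R)
  (Lam : {fset d.-tuple nat})
  (phi : 'I_K -> d.-tuple (measurableTypeR R) -> R)
  (g theta : R) (G : grid R) (B : R * R -> 'cV[R]_K)
  (A : cell_averages R K) (C : set (int * int))
  (rho_density : is_density rho)
  (rho_moments : finite_moments rho)
  (Lam0 : [tuple of nseq d 0%N] \in Lam)
  (card_Lam : #|` Lam| = K)
  (phi_basis : orthonormal_basis rho (poly_space Lam) phi)
  (phi1 : forall k : 'I_K, val k = 0%N -> forall s, phi k s = 1)
  (g_gt0 : 0 < g)
  (theta_bounds : 1 <= theta <= 2)
  (hyperbolic : forall i j : int, C (i, j) ->
     let M := galerkin rho phi in
     [/\ posdef_xface M theta G B A (i - 1) j, posdef_xface M theta G B A i j,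
         posdef_yface M theta G B A i (j - 1) & posdef_yface M theta G B A i j])
  (rest : lake_at_rest G B A (with_ghosts C)) :
  forall i j : int, C (i, j) ->
    scheme_rhs (galerkin rho phi) g theta G B A i j = 0.
Proof.
move=> i j Cij; have [eta etaP] := rest.
have K_gt0 : (0 < K)%N.
  by rewrite -card_Lam cardfs_gt0; apply/fset0Pn; exists [tuple of nseq d 0%N].
apply: (scheme_rhs_rest _ _ _ _ _ _ eta) => //.
- exact: galerkin_sym.
- by move=> k kb; apply: etaP; exists (i, j) => //; left; split => //=; lia.
- by move=> k kb; apply: etaP; exists (i, j) => //; right; split => //=; lia.
- exact: hyperbolic.
Qed.
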